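(* Let $(u,p;\lambda)$ be a saddle point of $\mathcal{L}_\tau$ and let $(u^j,p^j;\lambda^j)$, $j\ge0$, be the iterates of the Generalized ADMM (defined in the context). For all $j\ge 1$, $$\widehat{\varrho}_F(p,p^j)+\widehat{\varrho}_G(u,u^j)+\widehat{\varrho}_G(u^{j-1},u^j)\le 2C_0R_j$$ with $$C_0=\max\Bigl\{\frac{1}{\tau_j}\|\lambda\|_Y+\|Bu\|_Y,\ \frac{1}{\tau_j}\|\lambda^j\|_Y+\|Bu^j\|_Y\Bigr\}.$$
   Context: $X,Y$ are real Hilbert spaces with inner products $(\cdot,\cdot)_X,(\cdot,\cdot)_Y$, identified with their duals. $F:Y\to\mathbb{R}\cup\{+\infty\}$ and $G:X\to\mathbb{R}\cup\{+\infty\}$ are convex, proper and lower semicontinuous, and $B:X\to Y$ is a bounded linear operator such that $u\mapsto F(Bu)+G(u)$ is proper and coercive. For $\tau>0$, $$\mathcal{L}_\tau(u,p;\lambda)=F(p)+G(u)+(\lambda,Bu-p)_Y+\frac{\tau}{2}\|Bu-p\|_Y^2 ,$$ and $(u,p;\lambda)\in X\times Y\times Y$ is a saddle point of $\mathcal{L}_\tau$ if $\mathcal{L}_\tau(u,p;\mu)\le\mathcal{L}_\tau(u,p;\lambda)\le\mathcal{L}_\tau(v,q;\lambda)$ for all $(v,q,\mu)\in X\times Y\times Y$. It is assumed that a saddle point exists. Coercivity functionals: $\varrho_F:Y\times Y\to\mathbb{R}$ and $\varrho_G:X\times X\to\mathbb{R}$ are nonnegative functionals describing possible strong convexity of $F$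 and $G$: whenever $\mu\in\partial F(p)$, $(\mu,q-p)_Y+F(p)+\varrho_F(q,p)\le F(q)$ for all $q\in Y$; whenever $\xi\in\partial G(u)$, $(\xi,v-u)_X+G(u)+\varrho_G(v,u)\le G(v)$ for all $v\in X$. Their symmetrizations are $\widehat{\varrho}_G(u,u')=\varrho_G(u,u')+\varrho_G(u',u)$ and $\widehat{\varrho}_F(p,p')=\varrho_F(p,p')+\varrho_F(p',p)$. Generalized ADMM: choose $(u^0,\lambda^0)\in X\times Y$ with $G(u^0)<\infty$, $\overline{\tau}\ge\underline{\tau}>0$, and set $\tau_1=\overline{\tau}$. For $j=1,2,\dots$: compute a minimizer $p^j\in Y$ of $p\mapsto\mathcal{L}_{\tau_j}(u^{j-1},p;\lambda^{j-1})$; compute a minimizer $u^j\in X$ of $u\mapsto\mathcal{L}_{\tau_j}(u,p^j;\lambda^{j-1})$ (minimizers are assumed to exist); set $\lambda^j=\lambda^{j-1}+\tau_j(Bu^j-p^j)$; define the residual $R_j=\bigl(\|\lambda^j-\lambda^{j-1}\|_Y^2+\tau_j^2\|B(u^j-u^{j-1})\|_Y^2\bigr)^{1/2}$; choose $\tau_{j+1}\in[\underline{\tau},\overline{\tau}]$. The iterates are regarded as an infinite sequence (the stopping test is ignored).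
   Formalization: For j = 1 the bound is proved under the added assumption −B*λ⁰ ∈ ∂G(u⁰) on the initial values; without it the claim fails (B = 0, F the indicator of {0}, G(u) = u²/2, u⁰ = 1, λ⁰ = 0 gives R₁ = 0 but left side 1). For j ≥ 2 nothing is added. *)

(* Defs.v *)
From HB Require Import structures.
From mathcomp Require Import all_boot all_order all_algebra.
From mathcomp Require Import all_classical all_reals all_analysis.

Set Implicit Arguments.
Unset Strict Implicit.
Unset Printing Implicit Defensive.

Import Order.TTheory GRing.Theory Num.Theory.
Import numFieldNormedType.Exports.

Local Open Scope classical_set_scope.
Local Open Scope ring_scope.

(* A real Hilbert space is a [completeNormedModType R] together with a real
   inner product [ip : {dot X for idfun}] that induces its norm. *)
Definition induces_norm (R : realType) (X : normedModType R)
    (ip : {dot X for idfun}) : Prop :=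
  forall x : X, `|x| ^+ 2 = ip x x.

Section ConvexAnalysis.
Context {R : realType} {X : normedModType R}.
Local Open Scope ereal_scope.
Implicit Types f : X -> \bar R.

(* Not identically +oo, and with values in R u {+oo}. *)
Definition proper_fun f : Prop :=
  (forall x, f x != -oo) /\ (exists x, f x < +oo).

(* [convex_function] of the library only covers finite-valued functions.
   In \bar R, 0 * +oo = 0, so the cases t = 0 and t = 1 hold trivially. *)
Definition convex_efun f : Prop :=
  forall (x y : X) (t : R), (0 <= t <= 1)%R ->
    f (t *: x + (1 - t) *: y)%R <= t%:E * f x + (1 - t)%:E * f y.

Definition coercive_fun f : Prop :=
  forall A : R, exists r : R, forall x, (r < `|x|)%R -> A%:E <= f x.

Definition minimizes f (x : X) : Prop := forall y, f x <= f y.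

(* Dual elements are represented in X through the inner product.  For proper f
   this set is empty at points where f is +oo. *)
Definition subdifferential (ip : {dot X for idfun}) f (x : X) : set X :=
  [set xi | forall y, (ip xi (y - x)%R)%:E + f x <= f y].

(* The first argument of [rho] is the free point and the second one the base
   point of the subgradient inequality. *)
Definition coercivity_functional (ip : {dot X for idfun}) f
    (rho : X -> X -> R) : Prop :=
  (forall y x, 0 <= rho y x)%R /\
  (forall x xi, subdifferential ip f x xi ->
     forall y, (ip xi (y - x)%R)%:E + f x + (rho y x)%:E <= f y).

End ConvexAnalysis.

Definition symmetrization {R : realType} {X : Type} (rho : X -> X -> R)
    (x y : X) : R :=
  rho x y + rho y x.

Section ADMM.
Context {R : realType} {X Y : completeNormedModType R}.
Variables (ipX : {dot X for idfun}) (ipY : {dot Y for idfun}).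
Variables (F : Y -> \bar R) (G : X -> \bar R) (B : {linear X -> Y}).

Definition aug_lagrangian (tau : R) (u : X) (p l : Y) : \bar R :=
  (F p + G u + (ipY l (B u - p))%:E + (tau / 2 * `|B u - p| ^+ 2)%:E)%E.

Definition saddle_point (tau : R) (u : X) (p l : Y) : Prop :=
  forall (v : X) (q mu : Y),
    (aug_lagrangian tau u p mu <= aug_lagrangian tau u p l)%E /\
    (aug_lagrangian tau u p l <= aug_lagrangian tau v q l)%E.

(* The step written here for j.+1 is step j of the algorithm for j = 1, 2, ...
   The values [p_ 0] and [tau_ 0] play no role. *)
Record admm_iterates (taulo tauhi : R) (tau_ : nat -> R)
    (u_ : nat -> X) (p_ l_ : nat -> Y) : Prop := AdmmIterates {
  admm_taulo_gt0 : 0 < taulo ;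
  admm_tau_le : taulo <= tauhi ;
  admm_u0 : (G (u_ 0%N) < +oo)%E ;
  admm_tau1 : tau_ 1%N = tauhi ;
  admm_p : forall j,
    minimizes (fun p => aug_lagrangian (tau_ j.+1) (u_ j) p (l_ j)) (p_ j.+1) ;
  admm_u : forall j,
    minimizes (fun u => aug_lagrangian (tau_ j.+1) u (p_ j.+1) (l_ j))
      (u_ j.+1) ;
  admm_l : forall j,
    l_ j.+1 = l_ j + tau_ j.+1 *: (B (u_ j.+1) - p_ j.+1) ;
  admm_tau : forall j, taulo <= tau_ j.+2 <= tauhi
}.

(* Meaningful for 1 <= j. *)
Definition residual (tau_ : nat -> R) (u_ : nat -> X) (l_ : nat -> Y)
    (j : nat) : R :=
  Num.sqrt (`|l_ j - l_ j.-1| ^+ 2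
            + tau_ j ^+ 2 * `|B (u_ j - u_ j.-1)| ^+ 2).

(* - B^* l \in \partial G(u), the element xi = - B^* l of X being determined
   by (xi, v)_X = - (l, B v)_Y.  Every pair (u^j, l^j) with 1 <= j satisfies
   it, by optimality of u^j.  For j = 0 it is an assumption on the initial
   values, without which the bound on the term \rho_G(u^0, u^1) +
   \rho_G(u^1, u^0) fails: take X = Y = R, B = 0, F the indicator of {0},
   G(u) = u^2/2, \rho_F = 0, \rho_G(v, u) = (v - u)^2/2, the saddle point
   (0, 0; 0), u^0 = 1 and l^0 = 0.  Then u^1 = p^1 = l^1 = 0, so that
   R_1 = 0. *)
Definition dual_compatible (u : X) (l : Y) : Prop :=
  exists2 xi : X, subdifferential ipX G u xi
    & forall v : X, ipX xi v = - ipY l (B v).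

End ADMM.

(* Main.v *)
(* The optimality conditions of the two minimization steps read
     l^j - tau_j B (u^j - u^{j-1}) \in \partial F(p^j),
     - B^* l^j \in \partial G(u^j),
   and the saddle point satisfies l \in \partial F(p), - B^* l \in \partial G(u)
   and B u = p.  Adding the strengthened subgradient inequalities in pairs bounds
   the three symmetrized functionals.  With a := l^j - l^{j-1} and
   d := B (u^j - u^{j-1}), the relation p^j = B u^j - a / tau_j makes the terms
   (a, d) cancel in the sum of these bounds, which is thus
     (l - l^j, a) / tau_j + tau_j (d, B (u - u^j)),
   and |a|, tau_j |d| <= R_j.  Since subgradients of G are vectors of X, - B^* l
   is obtained from the Riesz representation theorem. *)
Require Import Defs.
From HB Require Import structures.
From mathcomp Require Import all_boot all_order all_algebra.
From mathcomp Require Import all_classical all_reals all_analysis.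
From mathcomp Require Import lra.

Set Implicit Arguments.
Unset Strict Implicit.
Unset Printing Implicit Defensive.

Import Order.TTheory GRing.Theory Num.Theory.
Import numFieldNormedType.Exports.
Local Open Scope classical_set_scope.
Local Open Scope ring_scope.

(** * Inner product calculus and the Cauchy-Schwarz inequality *)

Section InnerProduct.
Context (R : realType) (X : normedModType R) (ip : {dot X for idfun}).
Hypothesis ip_norm : induces_norm ip.
Implicit Types x y z : X.

Lemma dot_sym x y : ip x y = ip y x.
Proof. by rewrite hermC expr0 mul1r. Qed.

Lemma dotZl (a : R) x y : ip (a *: x) y = a * ip x y.
Proof. by rewrite linearZl_LR. Qed.

Lemma dotZr (a : R) x y : ip x (a *: y) = a * ip x y.
Proof. by rewrite linearZr_LR. Qed.

Lemma dotDl x y z : ip (x + y) z = ip x z + ip y z.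
Proof. exact: linearDl. Qed.

Lemma dotDr x y z : ip x (y + z) = ip x y + ip x z.
Proof. exact: linearDr. Qed.

Lemma dotNl x y : ip (- x) y = - ip x y.
Proof. exact: linearNl. Qed.

Lemma dotNr x y : ip x (- y) = - ip x y.
Proof. exact: linearNr. Qed.

Definition dotE := (dotDl, dotDr, dotNl, dotNr, dotZl, dotZr).

(** The norm is given, so this is read off the squared triangle inequality by expanding
    [|x + y| ^+ 2]. *)
Lemma dot_CauchySchwarz x y : ip x y <= `|x| * `|y|.
Proof.
have : `|x + y| ^+ 2 <= (`|x| + `|y|) ^+ 2.
  by rewrite lerXn2r ?nnegrE ?addr_ge0 ?ler_normD.
by rewrite ip_norm !dotE (dot_sym y) -!ip_norm => ?; nra.
Qed.

End InnerProduct.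

(** * First-order conditions, Riesz representation and monotone subdifferentials *)

Lemma fin_num_proper (R : realType) (X : normedModType R) (f : X -> \bar R) x :
  proper_fun f -> (f x < +oo)%E -> exists r : R, f x = r%:E.
Proof. by move=> [/(_ x) + _]; case: (f x) => // r _ _; exists r. Qed.

Lemma ge0_perturbation (R : realFieldType) (a b : R) :
  (forall e, 0 < e <= 1 -> 0 <= a + e * b) -> 0 <= a.
Proof.
move=> ab; rewrite leNgt; apply/negP => a0.
have b0 := normr_ge0 b; have c0 : 0 < `|b| - a by lra.
(* With c = |b| - a and e = - a / c, c (a + e b) = a (|b| - b - a), which is negative when a < 0. *)
have /ab : 0 < - a / (`|b| - a) <= 1.
  by rewrite divr_gt0 ?oppr_gt0 //= ler_pdivrMr // mul1r; lra.
rewrite mulrAC -(ler_pM2r c0) mul0r mulrDl divfK ?gt_eqF //.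
by have := ler_norm b; nra.
Qed.

(** Compare x with x + t (y - x), use convexity of f, divide by t and let t tend to 0. Here [a]
    plays minus the derivative of g at x; it is a plain function, so that no representing vector is
    required yet. *)
Lemma minimizer_subgradient (R : realType) (X : normedModType R)
    (f : X -> \bar R) (g : X -> R) (a b : X -> R) (x : X) :
  proper_fun f -> convex_efun f ->
  minimizes (fun y => f y + (g y)%:E)%E x ->
  (forall d t, g (x + t *: d) <= g x - t * a d + t ^+ 2 * b d) ->
  (f x < +oo)%E /\ forall y, ((a (y - x)%R)%:E + f x <= f y)%E.
Proof.
move=> fP fC xmin gP.
have fx_fin : (f x < +oo)%E.
  have [_ [y fy]] := fP; have [fyr fyE] := fin_num_proper fP fy.
  have := xmin y; rewrite fyE -EFinD.
  by case: (f x) => [r| |] //; rewrite ltry.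
split=> // y; have [fxr fxE] := fin_num_proper fP fx_fin.
have [fy_fin|] := boolP (f y < +oo)%E; last first.
  by rewrite ltey negbK => /eqP ->; rewrite leey.
have [fyr fyE] := fin_num_proper fP fy_fin.
rewrite fxE fyE -EFinD lee_fin.
have key t : 0 < t <= 1 -> a (y - x) + fxr - fyr <= t * b (y - x).
  move=> /andP[t0 t1].
  have := fC y x t; rewrite (ltW t0) t1 => /(_ isT).
  have -> : t *: y + (1 - t) *: x = x + t *: (y - x).
    by rewrite scalerBl scale1r scalerBr addrC addrA addrAC.
  move=> cvx; have := xmin (x + t *: (y - x)); have := gP (y - x) t.
  move: cvx; rewrite fxE fyE -!EFinM -!EFinD.
  have [/(_ (x + t *: (y - x))) + _] := fP.
  case: (f _) => [r| |] // _; rewrite -?EFinD !lee_fin => h1 h2 h3.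
  by rewrite -(ler_pM2l t0); nra.
rewrite -subr_ge0; apply: (@ge0_perturbation _ _ (b (y - x))) => t /key.
lra.
Qed.

(* The representing vector is the limit of a minimizing sequence of
   J v = |v|^2 - 2 phi v.  No continuity of J is used: expanding
   inf J <= J (v_n + t d) and letting n -> oo, then t -> 0, gives
   phi d <= ip xi d. *)
Lemma Riesz_representation (R : realType) (X : completeNormedModType R)
    (ip : {dot X for idfun}) (phi : X -> R) (M : R) :
  induces_norm ip -> scalar phi -> (forall x, `|phi x| <= M * `|x|) ->
  exists xi : X, forall v, ip xi v = phi v.
Proof.
move=> ip_norm philin phiM.
pose J v := ip v v - 2 * phi v; pose m := inf (range J).
have phi0 : phi 0 = 0.
  by have := philin 1 0 0; rewrite scaler0 addr0 mul1r => ?; lra.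
have phiD v w : phi (v + w) = phi v + phi w.
  by rewrite -[v]scale1r philin scale1r mul1r.
have phiZ c v : phi (c *: v) = c * phi v.
  by rewrite -[c *: v]addr0 philin phi0 addr0.
have lbJ : has_lbound (range J).
  (* |v|^2 - 2 M |v| + M^2 is a square. *)
  exists (- M ^+ 2) => _ [v _ <-]; rewrite /J -ip_norm.
  have := phiM v; have := ler_norm (phi v); have := sqr_ge0 (`|v| - M); nra.
have mJ v : m <= J v by apply: ge_inf => //; exists v.
have [v_ v_P] : {v_ : nat -> X & forall n, J (v_ n) < m + n.+1%:R^-1}.
  apply: (@choice _ _ (fun n v => J v < m + n.+1%:R^-1)) => n.
  have [||_ [v _ <-] ?] := @inf_adherent _ (range J) n.+1%:R^-1.
  - by rewrite invr_gt0 ltr0Sn.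
  - by split=> //; exists (J 0), 0.
  - by exists v.
(* Parallelogram identity, with the midpoint value bounded below by m. *)
have dist v w : `|v - w| ^+ 2 <= 2 * (J v + J w - 2 * m).
  have := mJ (2^-1 *: (v + w)).
  by rewrite /J ip_norm phiZ phiD !(dotE ip) (dot_sym ip w v) => ?; lra.
have inv_small (e : R) : 0 < e -> \forall n \near \oo, n.+1%:R^-1 < e.
  by move=> e0; near=> n; near: n; exact: near_infty_natSinv_lt (PosNum e0).
have cv : cvgn v_.
  apply: cauchy_cvg; apply: cauchy_exP => e e0.
  (* By [dist], |v_N - v_n|^2 < 2 (1/(N+1) + 1/(n+1)) < e^2. *)
  have [|N _ NP] := inv_small (e ^+ 2 / 4).
    by rewrite divr_gt0 ?exprn_gt0.
  exists (v_ N); exists N => // n /= Nn.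
  rewrite -ball_normE /= -(@ltr_pXn2r _ 2) ?nnegrE ?(ltW e0) //.
  apply: le_lt_trans (dist _ _) _.
  have := NP N (leqnn N); have := NP n Nn.
  have := v_P N; have := v_P n => /=.
  by move: (J _) (J _) (_^-1) (_^-1) => *; lra.
pose xi : X := lim (v_ @ \oo).
have ge0 d : 0 <= ip xi d - phi d.
  (* The outer perturbation removes the term t |d|^2 / 2, the inner one the errors from J (v_n) < m
     + e and |xi - v_n| < e. *)
  apply: (@ge0_perturbation _ _ (`|d| ^+ 2 / 2)) => t /andP[t0 _].
  rewrite -(pmulr_rge0 _ t0).
  apply: (@ge0_perturbation _ _ (2^-1 + t * `|d|)) => e /andP[e0 _].
  have [n [xie ne]] : exists n, `|xi - v_ n| < e /\ n.+1%:R^-1 < e.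
    apply: (@filter_ex _ \oo); near=> n; split; near: n; last exact: inv_small.
    by move/cvgrPdist_lt : cv; apply.
  have := mJ (v_ n + t *: d).
  have : J (v_ n) < m + e by rewrite (lt_trans (v_P n)) ?ltrD2l.
  have : ip (v_ n - xi) d <= e * `|d|.
    apply: le_trans (dot_CauchySchwarz ip_norm _ _) _.
    by rewrite ler_wpM2r // distrC ltW.
  rewrite /J ip_norm phiD phiZ !(dotE ip) (dot_sym ip d (v_ n)) => h1 h2 h3.
  have := ler_wpM2l (ltW t0) h1; nra.
exists xi => d; apply/eqP; rewrite -subr_eq0 eq_le ge0 andbT -oppr_ge0.
have := ge0 (- d); rewrite (dotNr ip) -(scaleN1r d) phiZ; lra.
Unshelve. all: by end_near. Qed.

Lemma subgradient_monotone (R : realType) (X : normedModType R)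
    (ip : {dot X for idfun}) (f : X -> \bar R) (rho : X -> X -> R)
    (x x' xi xi' : X) :
  proper_fun f -> coercivity_functional ip f rho ->
  subdifferential ip f x xi -> subdifferential ip f x' xi' ->
  symmetrization rho x x' <= ip (xi - xi') (x - x').
Proof.
move=> fP [_ rhoP] xiP xiP'.
(* The subgradient inequality tested at a point of the domain forces f y to be finite. *)
have fin y eta : subdifferential ip f y eta -> exists r : R, f y = r%:E.
  move=> yP; apply: (fin_num_proper fP).
  have [_ [z fz]] := fP; have := le_lt_trans (yP z) fz.
  by case: (f y) => [s| |] /=; rewrite ?ltry ?ltNyr.
have [r fx] := fin _ _ xiP; have [r' fx'] := fin _ _ xiP'.
have := rhoP _ _ xiP x'; have := rhoP _ _ xiP' x.
rewrite /symmetrization fx fx' -!EFinD !lee_fin !(dotE ip); lra.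
Qed.

Section Optimality.
Context (R : realType) (X Y : completeNormedModType R).
Context (ipX : {dot X for idfun}) (ipY : {dot Y for idfun}).
Hypotheses (ipX_norm : induces_norm ipX) (ipY_norm : induces_norm ipY).
Context (F : Y -> \bar R) (G : X -> \bar R) (B : {linear X -> Y}).
Hypotheses (F_proper : proper_fun F) (F_convex : convex_efun F).
Hypotheses (G_proper : proper_fun G) (G_convex : convex_efun G).
Hypothesis B_bounded : bounded_near B (nbhs 0).

(** Boundedness of B makes v |-> - (l, B v) a bounded functional, so Riesz supplies the vector - B^*
    l. *)
Lemma dual_compatible_represented (u : X) (l : Y) :
  (forall v, ((- ipY l (B (v - u)))%:E + G u <= G v)%E) ->
  dual_compatible ipX ipY G B u l.
Proof.
move=> uP.
have [M BM] : exists M, forall v, `|B v| <= M * `|v|.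
  by apply: (@filter_ex _ +oo); exact/linear_boundedP.
have [|v|xi xiP] := @Riesz_representation _ _ _ (fun v => - ipY l (B v))
    (`|l| * M) ipX_norm.
- by move=> a v w /=; rewrite linearP !(dotE ipY) opprD mulrN.
- rewrite ler_norml lerN2 -(dotNl ipY).
  have BMl : `|l| * `|B v| <= `|l| * M * `|v| by rewrite -mulrA ler_wpM2l.
  apply/andP; split; apply: le_trans (dot_CauchySchwarz ipY_norm _ _) _ => //.
  by rewrite normrN.
- by exists xi => // v; rewrite xiP.
Qed.

Lemma minimizes_aug_lagrangian_p (tau : R) (u : X) (p l : Y) :
  (G u < +oo)%E -> minimizes (fun q => aug_lagrangian ipY F G B tau u q l) p ->
  (F p < +oo)%E /\ subdifferential ipY F p (l + tau *: (B u - p)).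
Proof.
move=> Gu pmin; have [r rE] := fin_num_proper G_proper Gu.
pose g q := r + ipY l (B u - q) + tau / 2 * `|B u - q| ^+ 2.
apply: (@minimizer_subgradient _ _ F g (ipY (l + tau *: (B u - p)))
  (fun d => tau / 2 * `|d| ^+ 2)) => //.
- move=> q; have := pmin q.
  by rewrite /aug_lagrangian rE -!addeA -!EFinD /g !addrA.
- move=> d t; rewrite /g !ipY_norm !(dotE ipY).
  by rewrite !(dot_sym ipY d); lra.
Qed.

(** The smooth part has derivative d |-> (l + tau (B u - p), B d) at u. In the algorithm, l + tau (B
    u - p) is exactly the updated multiplier. *)
Lemma minimizes_aug_lagrangian_u (tau : R) (u : X) (p l : Y) :
  (F p < +oo)%E -> minimizes (fun v => aug_lagrangian ipY F G B tau v p l) u ->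
  (G u < +oo)%E /\ dual_compatible ipX ipY G B u (l + tau *: (B u - p)).
Proof.
move=> Fp umin; have [r rE] := fin_num_proper F_proper Fp.
pose g v := r + ipY l (B v - p) + tau / 2 * `|B v - p| ^+ 2.
have [|d t|Gu uP] := @minimizer_subgradient _ _ G g
    (fun d => - ipY (l + tau *: (B u - p)) (B d))
  (fun d => tau / 2 * `|B d| ^+ 2) u G_proper G_convex.
- move=> v; have := umin v.
  by rewrite /aug_lagrangian rE ![(r%:E + _)%E]addeC -!addeA -!EFinD /g !addrA.
- rewrite /g; have -> : B (u + t *: d) = B u + t *: B d by rewrite linearD linearZ.
  rewrite !ipY_norm !(dotE ipY).
  by rewrite !(dot_sym ipY (B d)); lra.
- by split=> //; exact: dual_compatible_represented.
Qed.

Lemma saddle_point_finite (tau : R) (u : X) (p l : Y) :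
  saddle_point ipY F G B tau u p l -> (F p < +oo)%E /\ (G u < +oo)%E.
Proof.
move=> sad; have [[Fny [q Fq]] [Gny [v Gv]]] := (F_proper, G_proper).
have [s sE] := fin_num_proper F_proper Fq.
have [r rE] := fin_num_proper G_proper Gv.
have [_] := sad v q l; rewrite /aug_lagrangian sE rE.
move: (Fny p) (Gny u); case: (F p) => [?||]; case: (G u) => [?||] //=.
by rewrite !ltry.
Qed.

Lemma saddle_point_constraint (tau : R) (u : X) (p l : Y) :
  saddle_point ipY F G B tau u p l -> B u = p.
Proof.
move=> sad; have [Fp Gu] := saddle_point_finite sad.
have [s sE] := fin_num_proper F_proper Fp.
have [r rE] := fin_num_proper G_proper Gu.
(* This multiplier turns the left saddle inequality into |B u - p|^2 <= 0. *)
have [+ _] := sad u p (l + (B u - p)).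
rewrite /aug_lagrangian sE rE -!EFinD lee_fin (dotDl ipY l) -ipY_norm => h.
apply/eqP; rewrite -subr_eq0 -normr_eq0 -sqrf_eq0 eq_le sqr_ge0 andbT; lra.
Qed.

(** Fixing one primal variable in the right saddle inequality makes the other a partial minimizer;
    since B u = p, the multiplier shift tau (B u - p) vanishes. *)
Lemma saddle_point_optimality (tau : R) (u : X) (p l : Y) :
  saddle_point ipY F G B tau u p l ->
  subdifferential ipY F p l /\ dual_compatible ipX ipY G B u l.
Proof.
move=> sad; have [Fp Gu] := saddle_point_finite sad.
have Bup := saddle_point_constraint sad.
have lE : l = l + tau *: (B u - p) by rewrite Bup subrr scaler0 addr0.
split; rewrite lE.
- apply: (minimizes_aug_lagrangian_p Gu _).2 => q.
  by have [_] := sad u q l.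
- apply: (minimizes_aug_lagrangian_u Fp _).2 => v.
  by have [_] := sad v p l.
Qed.

Lemma dual_compatible_monotone (rho : X -> X -> R) (u u' : X) (l l' : Y) :
  coercivity_functional ipX G rho ->
  dual_compatible ipX ipY G B u l -> dual_compatible ipX ipY G B u' l' ->
  symmetrization rho u u' <= - ipY (l - l') (B (u - u')).
Proof.
move=> rhoP [xi uP xiE] [xi' uP' xiE'].
have := subgradient_monotone G_proper rhoP uP uP'.
by rewrite (dotDl ipX) (dotNl ipX) xiE xiE' (dotDl ipY) (dotNl ipY) opprD.
Qed.

Lemma admm_optimality (taulo tauhi : R) (tau_ : nat -> R)
    (u_ : nat -> X) (p_ l_ : nat -> Y) (j : nat) :
  admm_iterates ipY F G B taulo tauhi tau_ u_ p_ l_ ->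
  subdifferential ipY F (p_ j.+1)
    (l_ j.+1 - tau_ j.+1 *: B (u_ j.+1 - u_ j)) /\
  dual_compatible ipX ipY G B (u_ j.+1) (l_ j.+1).
Proof.
move=> it.
have step k : (G (u_ k) < +oo)%E -> _ :=
  fun Gu => minimizes_aug_lagrangian_p Gu (admm_p it k).
have Gfin k : (G (u_ k) < +oo)%E.
  elim: k => [|k IHk]; first exact: admm_u0 it.
  exact: (minimizes_aug_lagrangian_u (step k IHk).1 (admm_u it k)).1.
have [Fp pP] := step j (Gfin j).
have [_ uP] := minimizes_aug_lagrangian_u Fp (admm_u it j).
split; rewrite (admm_l it) //.
(* The p-step sees the old u^j; the update of the multiplier accounts for the correction by tau B
   (u^{j+1} - u^j). *)
have BE : B (u_ j.+1 - u_ j) = B (u_ j.+1) - B (u_ j) by rewrite linearB.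
have -> // : l_ j + tau_ j.+1 *: (B (u_ j.+1) - p_ j.+1)
    - tau_ j.+1 *: B (u_ j.+1 - u_ j) = l_ j + tau_ j.+1 *: (B (u_ j) - p_ j.+1).
rewrite -addrA -scalerBr BE; congr (_ + _ *: _).
by rewrite opprB addrC addrA subrK.
Qed.

End Optimality.

(** * Positive step sizes and the final estimate *)

Lemma admm_tau_gt0 (R : realType) (X Y : completeNormedModType R)
    (ipY : {dot Y for idfun}) (F : Y -> \bar R) (G : X -> \bar R)
    (B : {linear X -> Y}) (taulo tauhi : R) (tau_ : nat -> R)
    (u_ : nat -> X) (p_ l_ : nat -> Y) (j : nat) :
  admm_iterates ipY F G B taulo tauhi tau_ u_ p_ l_ -> 0 < tau_ j.+1.
Proof.
move=> it; apply: (lt_le_trans (admm_taulo_gt0 it)).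
case: j => [|j]; first by rewrite (admm_tau1 it) (admm_tau_le it).
by case/andP: (admm_tau it j).
Qed.

Theorem corollary3p9
  (R : realType) (X Y : completeNormedModType R)
  (ipX : {dot X for idfun}) (ipY : {dot Y for idfun})
  (hipX : induces_norm ipX) (hipY : induces_norm ipY)
  (F : Y -> \bar R) (G : X -> \bar R)
  (F_convex : convex_efun F) (F_proper : proper_fun F)
  (F_lsc : lower_semicontinuous F)
  (G_convex : convex_efun G) (G_proper : proper_fun G)
  (G_lsc : lower_semicontinuous G)
  (B : {linear X -> Y}) (B_bounded : bounded_near B (nbhs 0))
  (FG_proper : proper_fun (fun v : X => F (B v) + G v)%E)
  (FG_coercive : coercive_fun (fun v : X => F (B v) + G v)%E)
  (rhoF : Y -> Y -> R) (rhoG : X -> X -> R)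
  (rhoF_coercivity : coercivity_functional ipY F rhoF)
  (rhoG_coercivity : coercivity_functional ipX G rhoG)
  (tau : R) (tau_gt0 : 0 < tau)
  (u : X) (p l : Y) (saddle : saddle_point ipY F G B tau u p l)
  (taulo tauhi : R) (tau_ : nat -> R) (u_ : nat -> X) (p_ l_ : nat -> Y)
  (iterates : admm_iterates ipY F G B taulo tauhi tau_ u_ p_ l_)
  (j : nat) (j_ge1 : (1 <= j)%N)
  (start : j = 1%N -> dual_compatible ipX ipY G B (u_ 0%N) (l_ 0%N)) :
  let C0 := Num.max ((tau_ j)^-1 * `|l| + `|B u|)
                    ((tau_ j)^-1 * `|l_ j| + `|B (u_ j)|) in
  symmetrization rhoF p (p_ j) + symmetrization rhoG u (u_ j)
    + symmetrization rhoG (u_ j.-1) (u_ j)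
  <= 2 * C0 * residual B tau_ u_ l_ j.
Proof.
case: j j_ge1 start => [//|j] _ start; cbv zeta.
set C0 := Num.max _ _.
have Bup := saddle_point_constraint hipY F_proper G_proper saddle.
have [pP uP] := saddle_point_optimality hipX hipY F_proper F_convex G_proper
  G_convex B_bounded saddle.
have opt k := admm_optimality hipX hipY F_proper F_convex G_proper G_convex
  B_bounded k iterates.
have [pjP ujP] := opt j.
(* The pair before the first step is covered by [start], later ones by optimality of the preceding
   u-step. *)
have prevP : dual_compatible ipX ipY G B (u_ j) (l_ j).
  by case: j start {C0 pjP ujP} => [|j _]; [move/(_ erefl) | exact: (opt j).2].
have tau0 := admm_tau_gt0 j iterates; set t := tau_ j.+1 in C0 pjP tau0 *.
have := subgradient_monotone F_proper rhoF_coercivity pP pjP.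
have := dual_compatible_monotone G_proper rhoG_coercivity uP ujP.
have := dual_compatible_monotone G_proper rhoG_coercivity prevP ujP.
set a := l_ j.+1 - l_ j; set d := B (u_ j.+1 - u_ j) in pjP *.
have -> : l_ j - l_ j.+1 = - a by rewrite opprB.
have -> : B (u_ j - u_ j.+1) = - d by rewrite -linearN opprB.
(* From B u = p and the multiplier update a = t (B u^{j+1} - p^{j+1}). *)
have pE : p - p_ j.+1 = B (u - u_ j.+1) + t^-1 *: a.
  rewrite /a (admm_l iterates) [l_ j + _]addrC addrK scalerA mulVf ?gt_eqF // scale1r.
  by rewrite linearB -Bup addrA subrK.
rewrite pE -Bup /=; set e := B (u - u_ j.+1).
set R_ := residual _ _ _ _ _.
have aR : `|a| <= R_.
  rewrite -(ger0_norm (normr_ge0 a)) -sqrtr_sqr ler_wsqrtr // lerDl.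
  by rewrite mulr_ge0 ?sqr_ge0.
have dR : t * `|d| <= R_.
  rewrite -[X in X <= _]ger0_norm ?mulr_ge0 ?(ltW tau0) // -sqrtr_sqr.
  by rewrite ler_wsqrtr // exprMn lerDr sqr_ge0.
have R0 : 0 <= R_ := le_trans (normr_ge0 _) aR.
have h1 : t^-1 * ipY (l - l_ j.+1) a <= (t^-1 * `|l| + t^-1 * `|l_ j.+1|) * R_.
  rewrite -mulrDr -mulrA ler_pM2l ?invr_gt0 //.
  apply: le_trans (dot_CauchySchwarz hipY _ _) _.
  by rewrite ler_pM // ler_normB.
have h2 : t * ipY d e <= (`|B u| + `|B (u_ j.+1)|) * R_.
  rewrite mulrC; apply: le_trans (ler_wpM2r (ltW tau0) _) _.
    exact: (dot_CauchySchwarz hipY).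
  rewrite mulrC mulrA [leRHS]mulrC ler_pM ?mulr_ge0 ?(ltW tau0) //.
  by rewrite /e linearB ler_normB.
have C1 : t^-1 * `|l| + `|B u| <= C0 by rewrite le_max lexx.
have C2 : t^-1 * `|l_ j.+1| + `|B (u_ j.+1)| <= C0 by rewrite le_max lexx orbT.
(* The coefficients of R in [h1] and [h2] add up to the two entries of the maximum, hence the factor
   2. Expanding the three monotonicity bounds cancels both (a, d) and (l - l^{j+1}, e). *)
have := ler_wpM2r R0 C1; have := ler_wpM2r R0 C2; move: h1 h2.
clearbody a d e.
rewrite !(dotE ipY) !(dot_sym ipY d) mulVKf ?gt_eqF // => *; lra.
Qed.
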